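(* Let $d \ge 2$, let $P \le G(d)$ be an essential pattern group of pattern size $d$, and let $G_P$ be the finitely constrained group of binary rooted tree automorphisms defined by $P$. If $\dim_{\mathcal{H}}(G_P) = 1 - \frac{1}{2^{d-1}}$, then $G_P$ is not topologically finitely generated.
   Context: Let $X=\{0,1\}$, let $X^n$ be the set of words of length $n$ over $X$, and let $X^*=\bigcup_{n\ge 0}X^n$, viewed as the binary rooted tree with root the empty word $\emptyset$, in which each vertex $w$ has the two children $w0,w1$. Put $X^{[d]}=\bigcup_{i=0}^{d}X^i$ (the finite binary rooted tree of depth $d$) and $X^{(d)}=\bigcup_{i=0}^{d-1}X^i$. Let $G=\mathrm{Aut}(X^* )$ and $G(d)=\mathrm{Aut}(X^{[d]})$ be the groups of rooted tree automorphisms, acting on the left. For $g\in G$ and $w\in X^*$, the section $g_w\in G$ is the unique automorphism with $g(wv)=g(w)g_w(v)$ for all $v \in X^*$. The label (activity) $g_{(w)}\in C_2=\{0,1\}$ of $g$ at $w$ is $1$ if $g_w$ exchanges the two vertices of $X^1$, and $0$ otherwise. Labels $g_{(w)}$ for $g\in G(d)$ and $w\in X^{(d)}$ are defined in the same way. An element of $G(d)$ is determined by its labels, and $G(d)$ is thereby identified with the set of all maps $X^{(d)}\to C_2$ (patterns of size $d$). A pattern group of size $d$ is a subgroup $P\le G(d)$. It is essential if for all $g\in P$ and $i\in\{0,1\}$ there is $h_i\in P$ with $(h_i)_{(w)}=g_{(iw)}$ for all $w\in X^{(d-1)}$. The finitely constrained group defined by $P$ is $G_P=\{g\in G \mid \text{for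 every } w\in X^* \text{ the pattern } X^{(d)} \to C_2,\ v\mapsto g_{(wv)}, \text{ belongs to } P\}$; it is a closed subgroup of $G$. Equip $G$ with the metric in which the distance between $g\ne h$ is $1/[G:G_n]$, where $G_n$ is the pointwise stabilizer of $X^n$ in $G$ and $n$ is the smallest $k$ for which there is $u\in X^k$ with $g_{(u)}\neq h_{(u)}$. The Hausdorff dimension $\dim_{\mathcal{H}}(H)$ of a closed subgroup $H$ of $G$ is taken with respect to this metric; it is given by $\dim_{\mathcal{H}}(H)=\liminf_{n\to\infty}\frac{\log_2[H:H_n]}{2^n-1}$, where $H_n=H\cap G_n$. A closed subgroup of $G$ is topologically finitely generated if it is the closure (in this metric topology) of a finitely generated subgroup of $G$. *)

(* Defs.v *)
From HB Require Import structures.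
From mathcomp Require Import all_boot all_order all_fingroup all_algebra.
From mathcomp Require Import finmap.
From mathcomp Require Import all_classical all_reals all_analysis.

Set Implicit Arguments.
Unset Strict Implicit.
Unset Printing Implicit Defensive.

Import Order.TTheory GRing.Theory Num.Theory.
Local Open Scope classical_set_scope.

(* The vertices of the binary rooted tree are the words [seq bool], and those
   of its truncation at depth [d] are the words [d.-bseq bool] of length at
   most [d]. *)
Definition child (u v : seq bool) : bool := [exists x : bool, v == rcons u x].

Definition is_tree_aut (f : seq bool -> seq bool) : Prop :=
  [/\ bijective f, f [::] = [::] & forall u v, child (f u) (f v) = child u v].

Record tree_aut := TreeAut {
  tree_aut_fun :> seq bool -> seq bool;
  tree_autP : is_tree_aut tree_aut_fun }.

HB.instance Definition _ := gen_eqMixin tree_aut.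
HB.instance Definition _ := gen_choiceMixin tree_aut.

Lemma tree_aut_ext (g h : tree_aut) : g =1 h -> g = h.
Proof.
case: g h => [g gP] [h hP] /= /funext gh; subst h.
by rewrite (Prop_irrelevance gP hP).
Qed.

Lemma is_tree_aut_id : is_tree_aut id.
Proof. by split=> //; exists id. Qed.

Lemma is_tree_aut_comp (g h : tree_aut) : is_tree_aut (g \o h).
Proof.
case: g h => [g [gb g0 gc]] [h [hb h0 hc]] /=; split.
- exact: bij_comp.
- by rewrite /= h0 g0.
- by move=> u v /=; rewrite gc hc.
Qed.

Lemma tree_aut_inv_exists (g : tree_aut) :
  exists h : tree_aut, cancel g h /\ cancel h g.
Proof.
case: g => [g [[h gh hg] g0 gc]]; have hP : is_tree_aut h.
  split; first by exists g.
    by rewrite -g0 gh.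
  by move=> u v; rewrite -gc !hg.
by exists (TreeAut hP).
Qed.

Definition tree_aut_one : tree_aut := TreeAut is_tree_aut_id.
Definition tree_aut_mul (g h : tree_aut) : tree_aut :=
  TreeAut (is_tree_aut_comp g h).
Definition tree_aut_inv (g : tree_aut) : tree_aut :=
  projT1 (cid (tree_aut_inv_exists g)).

Lemma tree_aut_mulA : associative tree_aut_mul.
Proof. by move=> f g h; apply: tree_aut_ext. Qed.

Lemma tree_aut_mul1 : left_id tree_aut_one tree_aut_mul.
Proof. by move=> g; apply: tree_aut_ext. Qed.

Lemma tree_aut_1mul : right_id tree_aut_one tree_aut_mul.
Proof. by move=> g; apply: tree_aut_ext. Qed.

Lemma tree_aut_mulV : left_inverse tree_aut_one tree_aut_inv tree_aut_mul.
Proof.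
move=> g; apply: tree_aut_ext => u /=.
by rewrite /tree_aut_inv; case: cid => h /= [gh hg]; rewrite gh.
Qed.

Lemma tree_aut_Vmul : right_inverse tree_aut_one tree_aut_inv tree_aut_mul.
Proof.
move=> g; apply: tree_aut_ext => u /=.
by rewrite /tree_aut_inv; case: cid => h /= [gh hg]; rewrite hg.
Qed.

HB.instance Definition _ := isGroup.Build tree_aut
  tree_aut_mulA tree_aut_mul1 tree_aut_1mul tree_aut_mulV tree_aut_Vmul.

(* For a tree automorphism [f], the length of [f w] is that of [w] and
   [f (w ++ v) = f w ++ section f w v]; see [tree_aut_section]. *)
Definition section (f : seq bool -> seq bool) (w v : seq bool) : seq bool :=
  drop (size w) (f (w ++ v)).

Definition label (f : seq bool -> seq bool) (w : seq bool) : bool :=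
  (section f w [:: false] == [:: true]) && (section f w [:: true] == [:: false]).

Lemma tree_aut_rcons (g : tree_aut) w x :
  exists y, g (rcons w x) = rcons (g w) y.
Proof.
case: g => g [_ _ gc] /=; have : child (g w) (g (rcons w x)).
  by rewrite gc; apply/existsP; exists x.
by case/existsP=> y /eqP; exists y.
Qed.

Lemma size_tree_aut (g : tree_aut) w : size (g w) = size w.
Proof.
elim/last_ind: w => [|w x IH]; first by case: (g) => ? [_ /= ->].
by have [y ->] := tree_aut_rcons g w x; rewrite !size_rcons IH.
Qed.

Lemma tree_aut_section (g : tree_aut) w v :
  g (w ++ v) = g w ++ section g w v.
Proof.
rewrite -[LHS](cat_take_drop (size w)); congr (_ ++ _).
elim/last_ind: v => [|v x IH].
  by rewrite cats0 -(size_tree_aut g w) take_size.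
have [y] := tree_aut_rcons g (w ++ v) x; rewrite -rcons_cat => ->.
rewrite -cats1 take_cat size_tree_aut size_cat.
case: ltnP => [//|]; rewrite -[leqRHS]addn0 leq_add2l leqn0 => /eqP/size0nil v0.
move: IH; rewrite v0 cats0 addn0 subnn take0 cats0.
by rewrite -(size_tree_aut g w) take_size.
Qed.

Lemma tree_aut_label (g : tree_aut) w x :
  g (rcons w x) = rcons (g w) (x (+) label g w).
Proof.
have E z : exists y, section g w [:: z] = [:: y] /\
    g (rcons w z) = rcons (g w) y.
  have [y Ey] := tree_aut_rcons g w z; exists y; split=> //.
  by rewrite /section cats1 Ey -(size_tree_aut g w) -cats1 drop_size_cat.
have [y0 [s0 e0]] := E false; have [y1 [s1 e1]] := E true.
have ne : y0 != y1.
  apply/eqP => y01; have : g (rcons w false) = g (rcons w true).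
    by rewrite e0 e1 y01.
  case: (tree_autP g) => /bij_inj gi _ _ /gi /(congr1 (last true)).
  by rewrite !last_rcons.
by rewrite /label s0 s1; case: x; rewrite ?e0 ?e1; case: y0 y1 ne {s0 s1 e0 e1} => [] [].
Qed.

Lemma tree_aut_label_inj (g h : tree_aut) :
  (forall w, label g w = label h w) -> g = h.
Proof.
move=> gh; apply: tree_aut_ext; elim/last_ind => [|w x IH].
  by case: g h {gh} => [? [_ /= -> _]] [? [_ /= -> _]].
by rewrite !tree_aut_label IH gh.
Qed.

(* The group G(d), written as a subset of the group of all permutations of the
   vertices. The library composes permutations from left to right, which is
   immaterial for which subsets of G(d) are subgroups. *)
Definition trunc_aut (d : nat) : {set {perm d.-bseq bool}} :=
  [set p : {perm d.-bseq bool} | (p [bseq] == [bseq]) &&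
    [forall u, forall v, child (p u) (p v) == child u v]]%SET.

(* A permutation of the truncated tree as a map on all words; only its values
   on words of length at most [d] are meaningful. *)
Definition trunc_fun (d : nat) (p : {perm d.-bseq bool}) (w : seq bool) :
  seq bool := p (insub_bseq d w).

Definition trunc_label (d : nat) (p : {perm d.-bseq bool}) (w : seq bool) :
  bool := label (trunc_fun p) w.

Definition essential (d : nat) (P : {set {perm d.-bseq bool}}) : Prop :=
  forall g, g \in P -> forall i : bool, exists2 h, h \in P &
    forall w, (size w < d.-1)%N -> trunc_label h w = trunc_label g (i :: w).

Definition fin_constrained (d : nat) (P : {set {perm d.-bseq bool}}) :
  set tree_aut :=
  [set g : tree_aut | forall w, exists2 p, p \in P &
    forall v, (size v < d)%N -> trunc_label p v = label g (w ++ v)].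

Definition is_subgroup (T : groupType) (H : set T) : Prop :=
  group_closed (mem H).

Definition gen_subgroup (T : groupType) (S : set T) : set T :=
  smallest (@is_subgroup T) S.

(* The value is meaningful when there are finitely many left cosets. *)
Definition subgroup_index (T : groupType) (H K : set T) : nat :=
  #|` fset_set [set [set h * k | k in K]%g | h in H] |.

Definition level_stab (n : nat) : set tree_aut :=
  [set g : tree_aut | forall u, size u = n -> g u = u].

Definition diff_at_level (g h : tree_aut) (k : nat) : Prop :=
  exists2 u, size u = k & label g u != label h u.

Definition first_diff (g h : tree_aut) : nat :=
  xget 0%N [set n | diff_at_level g h n /\
                    forall k, diff_at_level g h k -> (n <= k)%N].

Definition tree_dist (R : realType) (g h : tree_aut) : R :=
  if g == h then 0%R
  else ((subgroup_index setT (level_stab (first_diff g h)))%:R^-1)%R.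

Lemma first_diffP (g h : tree_aut) : g != h ->
  diff_at_level g h (first_diff g h) /\
  forall k, diff_at_level g h k -> (first_diff g h <= k)%N.
Proof.
move=> gh; have [k gk] : exists k, `[< diff_at_level g h k >].
  apply: contrapT => nk; move/eqP: gh; apply; apply: tree_aut_label_inj => w.
  apply/eqP; apply: contrapT => /negP ghw.
  by apply: nk; exists (size w); apply/asboolP; exists w.
have ex : exists k, `[< diff_at_level g h k >] by exists k.
apply: (@xgetPex _ 0%N [set n | diff_at_level g h n /\
  forall k, diff_at_level g h k -> (n <= k)%N]); exists (ex_minn ex).
case: ex_minnP => m /asboolP dm mmin; split=> // j dj.
by apply: mmin; apply/asboolP.
Qed.

Lemma first_diff_sym (g h : tree_aut) : first_diff g h = first_diff h g.
Proof.
have E k : diff_at_level g h k <-> diff_at_level h g k.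
  by split=> -[u uk guh]; exists u => //; rewrite eq_sym.
rewrite /first_diff; congr xget; apply/seteqP.
by split=> k /= [/E dk km]; split=> // j /E; apply: km.
Qed.

Lemma level_stab_sub m n : (m <= n)%N -> level_stab n `<=` level_stab m.
Proof.
move=> mn g gn u um.
have := gn (u ++ nseq (n - m) false).
rewrite size_cat size_nseq um subnKC// => /(_ erefl).
rewrite tree_aut_section => /(congr1 (take (size u))).
by rewrite take_size_cat ?size_tree_aut// take_size_cat.
Qed.

Definition level_coset n (g : tree_aut) : set tree_aut :=
  [set g * k | k in level_stab n]%g.

Lemma level_cosetE n g :
  level_coset n g = [set h : tree_aut | forall u, size u = n -> h u = g u].
Proof.
apply/seteqP; split=> h /=.
  by move=> [k kn <-] u un /=; rewrite kn.
move=> hg; exists (g^-1 * h)%g; last by rewrite mulKVg.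
move=> u un; have -> : (g^-1 * h)%g u = (g^-1)%g (h u) by [].
by rewrite hg// -[RHS](congr1 (fun f : tree_aut => f u) (mulVg g)).
Qed.

Lemma finite_level_cosets n : finite_set [set level_coset n g | g in setT].
Proof.
pose restr (h : tree_aut) : {ffun n.-tuple bool -> n.-bseq bool} :=
  [ffun t : n.-tuple bool => insub_bseq n (h t)].
apply: (@sub_finite_set _ _
  ((fun r => [set h | restr h = r]) @` [set: {ffun n.-tuple bool -> n.-bseq bool}])).
  move=> _ [g _ <-]; exists (restr g) => //; rewrite level_cosetE.
  have K (h : tree_aut) (t : n.-tuple bool) : restr h t = h t :> seq bool.
    by rewrite ffunE /insub_bseq insubdK// unfold_in size_tree_aut size_tuple.
  apply/seteqP; split=> h /= hg; last first.
    apply/ffunP => t; apply: val_inj; rewrite /= !K.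
    by apply: hg; rewrite size_tuple.
  move=> u un; have un' : size u == n by apply/eqP.
  by have := K h (Tuple un'); rewrite hg K.
exact/finite_image/finite_finset.
Qed.

Lemma level_index_gt0 n : (0 < subgroup_index setT (level_stab n))%N.
Proof.
rewrite cardfs_gt0; apply/fset0Pn; exists (level_coset n 1%g).
rewrite in_fset_set; last exact: finite_level_cosets.
by rewrite inE; exists 1%g.
Qed.

Lemma leq_level_index m n : (m <= n)%N ->
  (subgroup_index setT (level_stab m) <= subgroup_index setT (level_stab n))%N.
Proof.
move=> mn; rewrite /subgroup_index.
pose phi (C : set tree_aut) : set tree_aut :=
  [set h | exists2 c, C c & forall u, size u = m -> h u = c u].
have -> : [set [set h * k | k in level_stab m]%g | h in setT] =
    phi @` [set [set h * k | k in level_stab n]%g | h in setT].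
  have E g : phi (level_coset n g) = level_coset m g.
    apply/seteqP; split=> h.
      move=> [_ [k kn <-] hc]; rewrite level_cosetE => u um.
      by rewrite hc//= (level_stab_sub mn kn).
    rewrite level_cosetE => hg; exists g => //.
    by exists 1%g; [move=> u _ | rewrite mulg1].
  apply/seteqP; split=> [_ [g _ <-]|_ [_ [g _ <-] <-]].
    by exists (level_coset n g); [exists g | exact: E].
  by exists g => //; rewrite -[LHS]/(level_coset m g) -E.
rewrite fset_set_image ?leq_imfset_card//; exact: finite_level_cosets.
Qed.

(* The tree automorphism group as a metric space with real distances in [R]. *)
Definition metric_tree_aut (R : realType) : Type := tree_aut.

Section TreeMetric.
Variable R : realType.

HB.instance Definition _ := Choice.on (metric_tree_aut R).

Let dist : metric_tree_aut R -> metric_tree_aut R -> R := @tree_dist R.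

Let distxx x : dist x x = 0%R.
Proof. by rewrite /dist /tree_dist eqxx. Qed.

Let dist_ge0 x y : (0 <= dist x y)%R.
Proof. by rewrite /dist /tree_dist; case: ifP => // _; rewrite invr_ge0 ler0n. Qed.

Let dist_positivity x y : dist x y = 0%R -> x = y.
Proof.
rewrite /dist /tree_dist; case: eqVneq => // _ /eqP.
by rewrite invr_eq0 pnatr_eq0 -leqn0 leqNgt level_index_gt0.
Qed.

Let dist_sym x y : dist x y = dist y x.
Proof. by rewrite /dist /tree_dist eq_sym first_diff_sym. Qed.

Let dist_triangle y x z : (dist x z <= dist x y + dist y z)%R.
Proof.
have [xz|xz] := eqVneq x z.
  by rewrite {1}xz distxx addr_ge0.
have [[u uk ux] _] := first_diffP xz.
have le (a b : tree_aut) : label a u != label b u -> (dist x z <= dist a b)%R.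
  move=> ab; have nab : a != b by apply: contraNneq ab => ->.
  have [_ /(_ (size u))] := first_diffP nab => /(_ (ex_intro2 _ _ u erefl ab)).
  rewrite uk => le_ab; rewrite /dist /tree_dist (negbTE xz) (negbTE nab).
  by rewrite lef_pV2 ?posrE ?ltr0n ?level_index_gt0// ler_nat leq_level_index.
have [xy|xy] := eqVneq (label x u) (label y u).
  by rewrite ler_wpDl// le// -xy.
by rewrite ler_wpDr// le.
Qed.

HB.instance Definition _ := isMetric.Build R (metric_tree_aut R)
  distxx dist_positivity dist_sym dist_triangle.

End TreeMetric.

Section HausdorffDimension.
Variables (R : realType) (T : metricType R).
Local Open Scope ereal_scope.

(* The term [0] only serves to give the empty set diameter [0]. *)
Definition diam (A : set T) : \bar R :=
  ereal_sup ([set 0] `|` [set (mdist x y)%:E | x in A & y in A]).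

Definition hausdorff_premeasure (s : R) (delta : R) (E : set T) : \bar R :=
  ereal_inf [set \sum_(0 <= k <oo) (diam (U k) `^ s) |
    U in [set U : nat -> set T |
      E `<=` \bigcup_k U k /\ forall k, diam (U k) <= delta%:E]].

(* The supremum over [delta] is the limit for [delta] tending to [0]. *)
Definition hausdorff_measure (s : R) (E : set T) : \bar R :=
  ereal_sup [set hausdorff_premeasure s delta E | delta in [set x : R | 0 < x]%R].

(* Only positive exponents are used, so that no convention for the zeroth power
   of the diameter of the empty set is needed. *)
Definition hausdorff_dim (E : set T) : \bar R :=
  ereal_inf [set s%:E | s in [set s : R | (0 < s)%R /\ hausdorff_measure s E = 0]].

End HausdorffDimension.

Definition topologically_fg (R : realType) (H : set tree_aut) : Prop :=
  exists2 S : set tree_aut, finite_set S &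
    H = closure (gen_subgroup S : set (metric_tree_aut R)).

(* Main.v *)
Require Import Defs.
From mathcomp Require Import all_boot all_order all_fingroup all_algebra.
From mathcomp Require Import finmap.
From mathcomp Require Import all_classical all_reals all_analysis.
From mathcomp Require Import lra ring.

(* Let V be the stabilizer of level d - 1 in G(d). Counting cylinders shows that
   if the intersection of P and V had index at least 4 in V, then the dimension
   of G_P would be at most 1 - (3/2)/2^(d-1); if P contained V, then essentiality
   would give P = G(d), and G has dimension 1. So the index is 2, and by
   essentiality P has index 2 in G(d). It is the kernel of a homomorphism chi to
   Z/2, which reads chi(g) = chi'(g_0) + chi'(g_1) + c g_(), with chi' a
   homomorphism. On G_P, where chi vanishes on all sections,
   g |-> c g_() + 2 chi'(g_0) is a homomorphism to Z/4, and so is the sum of its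
   values on the sections at level n, for each n. These sums are continuous and
   pairwise distinct, whereas a topologically finitely generated group has only
   finitely many continuous homomorphisms to Z/4. *)

Set Implicit Arguments.
Unset Strict Implicit.
Unset Printing Implicit Defensive.
Import GRing.Theory.

(** * Automorphisms and their labels *)

Fixpoint label_fun (l : seq bool -> bool) (w : seq bool) : seq bool :=
  if w is x :: v then (x (+) l [::]) :: label_fun (fun u => l (x :: u)) v
  else [::].

Lemma label_fun_rcons l w x :
  label_fun l (rcons w x) = rcons (label_fun l w) (x (+) l w).
Proof. by elim: w l => //= y w IH l; rewrite IH. Qed.

(** The label acts at the source vertex, so the inverse first recovers the source letter [y (+) l
    [::]] and descends along it rather than along [y]. *)
Fixpoint label_fun_inv (l : seq bool -> bool) (w : seq bool) : seq bool :=
  if w is y :: v then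
    (y (+) l [::]) :: label_fun_inv (fun u => l ((y (+) l [::]) :: u)) v
  else [::].

Lemma is_tree_aut_label_fun l : is_tree_aut (label_fun l).
Proof.
have bij : bijective (label_fun l).
  exists (label_fun_inv l) => w; elim: w l => //= x w IH l.
    by rewrite addbK IH.
  by rewrite addbK IH.
split=> // u v; apply/existsP/existsP => -[x /eqP vE]; last first.
  by exists (x (+) l u); rewrite vE label_fun_rcons.
exists (x (+) l u); apply/eqP/(bij_inj bij).
by rewrite vE label_fun_rcons addbK.
Qed.

(** Labels can be chosen freely: automorphisms are constructed below through this map and compared
    through [tree_aut_label_inj]. *)
Definition aut_of_label l : tree_aut := TreeAut (is_tree_aut_label_fun l).

Lemma rcons_inj2 (u v : seq bool) x y : rcons u x = rcons v y -> x = y.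
Proof. by move/(congr1 (last x)); rewrite !last_rcons. Qed.

Lemma labelE (g : tree_aut) w b :
  (forall x, g (rcons w x) = rcons (g w) (x (+) b)) -> label g w = b.
Proof. by move/(_ false); rewrite tree_aut_label => /rcons_inj2. Qed.

Lemma label_aut_of_label l w : label (aut_of_label l) w = l w.
Proof. by apply: labelE => x /=; rewrite label_fun_rcons. Qed.

Lemma label1 w : label (1%g : tree_aut) w = false.
Proof. by apply: labelE => x; rewrite addbF. Qed.

Lemma tree_mulE (g h : tree_aut) w : (g * h)%g w = g (h w).
Proof. by []. Qed.

Lemma tree_mulVE (g : tree_aut) w : (g^-1)%g (g w) = w.
Proof. by rewrite -tree_mulE mulVg. Qed.

Lemma tree_mulEV (g : tree_aut) w : g ((g^-1)%g w) = w.
Proof. by rewrite -tree_mulE mulgV. Qed.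

Lemma tree_aut_nil (g : tree_aut) : g [::] = [::].
Proof. by case: g => ? []. Qed.

Lemma labelM (g h : tree_aut) w :
  label (g * h)%g w = label g (h w) (+) label h w.
Proof.
by apply: labelE => x; rewrite !tree_mulE !tree_aut_label -addbA 
  (addbC (label h w)).
Qed.

(** Defined by its labels, hence an automorphism by construction; [tree_aut_cat] identifies it with
    the usual section. *)
Definition sec (g : tree_aut) (w : seq bool) : tree_aut :=
  aut_of_label (fun v => label g (w ++ v)).

Lemma label_sec g w v : label (sec g w) v = label g (w ++ v).
Proof. exact: label_aut_of_label. Qed.

Lemma sec0 g : sec g [::] = g.
Proof. by apply: tree_aut_label_inj => w; rewrite label_sec. Qed.

Lemma sec_cat g u v : sec g (u ++ v) = sec (sec g u) v.
Proof. by apply: tree_aut_label_inj => w; rewrite !label_sec catA. Qed.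

Lemma tree_aut_cat (g : tree_aut) w v : g (w ++ v) = g w ++ sec g w v.
Proof.
elim/last_ind: v => [|v x IH]; first by rewrite tree_aut_nil !cats0.
by rewrite -rcons_cat !tree_aut_label IH label_sec rcons_cat.
Qed.

Lemma secM (g h : tree_aut) w : sec (g * h)%g w = (sec g (h w) * sec h w)%g.
Proof.
by apply: tree_aut_label_inj => v; rewrite !(label_sec, labelM) tree_aut_cat.
Qed.

Lemma sec1 w : sec 1%g w = 1%g.
Proof. by apply: tree_aut_label_inj => v; rewrite label_sec !label1. Qed.

Lemma secV (g : tree_aut) w : sec (g^-1)%g w = ((sec g ((g^-1)%g w))^-1)%g.
Proof.
by apply: (@mulgI _ (sec g ((g^-1)%g w))); rewrite -secM !mulgV sec1.
Qed.

Lemma tree_aut1 (g : tree_aut) x : g [:: x] = [:: x (+) label g [::]].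
Proof. by rewrite (tree_aut_label g [::]) tree_aut_nil. Qed.

(* Swaps the two subtrees of the root, if [e], after acting by [a x] on the
   subtree at [x]. *)
Definition wreath (a : bool -> tree_aut) (e : bool) : tree_aut :=
  aut_of_label (fun w => if w is x :: v then label (a x) v else e).

Lemma label_wreath0 a e : label (wreath a e) [::] = e.
Proof. exact: label_aut_of_label. Qed.

Lemma label_wreath a e x w : label (wreath a e) (x :: w) = label (a x) w.
Proof. exact: label_aut_of_label. Qed.

Lemma sec_wreath a e x : sec (wreath a e) [:: x] = a x.
Proof. by apply: tree_aut_label_inj => w; rewrite label_sec label_wreath. Qed.

Lemma wreath_sec g : g = wreath (fun x => sec g [:: x]) (label g [::]).
Proof.
apply: tree_aut_label_inj => -[|x w]; first by rewrite label_wreath0.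
by rewrite label_wreath label_sec.
Qed.

Lemma eq_wreath a b e : a =1 b -> wreath a e = wreath b e.
Proof. by move=> /funext ->. Qed.

Lemma wreathM a b e f : (wreath a e * wreath b f)%g =
  wreath (fun x => a (x (+) f) * b x)%g (e (+) f).
Proof.
rewrite [LHS]wreath_sec labelM tree_aut_nil !label_wreath0.
apply: eq_wreath => x.
by rewrite secM tree_aut1 label_wreath0 !sec_wreath.
Qed.

Lemma wreath1 : wreath (fun=> 1%g) false = 1%g.
Proof.
apply: tree_aut_label_inj => -[|x w];
  by rewrite ?label_wreath0 ?label_wreath !label1.
Qed.

(** Congruence modulo the stabilizer of level [n]; in particular [agree n 1%g g] says that [g] fixes
    level [n] pointwise. *)
Definition agree (n : nat) (g h : tree_aut) : Prop :=
  forall w, (size w < n)%N -> label g w = label h w.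

Lemma agreeE n g h : agree n g h -> forall w, (size w <= n)%N -> g w = h w.
Proof.
move=> gh; elim/last_ind => [|w x IH]; first by rewrite !tree_aut_nil.
by rewrite size_rcons => wn; rewrite !tree_aut_label IH 1?ltnW// gh.
Qed.

Lemma agreeP n (g h : tree_aut) :
  (forall w, (size w <= n)%N -> g w = h w) -> agree n g h.
Proof.
move=> gh w wn; have := gh (rcons w false); rewrite size_rcons => /(_ wn).
by rewrite !tree_aut_label => /rcons_inj2.
Qed.

Lemma agree_sym n g h : agree n g h -> agree n h g.
Proof. by move=> gh w wn; rewrite gh. Qed.

Lemma agree_trans n h g f : agree n g h -> agree n h f -> agree n g f.
Proof. by move=> gh hf w wn; rewrite gh// hf. Qed.

Lemma agree_leq m n g h : (m <= n)%N -> agree n g h -> agree m g h.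
Proof. by move=> mn gh w wm; apply/gh/(leq_trans wm). Qed.

Lemma agreeM n g g' h h' : agree n g g' -> agree n h h' ->
  agree n (g * h)%g (g' * h')%g.
Proof.
move=> gg hh w wn; rewrite !labelM hh// gg ?size_tree_aut//.
by rewrite (agreeE hh)// ltnW.
Qed.

Lemma agree_sec m n g h w : (m + size w <= n)%N -> agree n g h ->
  agree m (sec g w) (sec h w).
Proof.
move=> mn gh v vm; rewrite !label_sec gh// size_cat addnC.
by apply: leq_trans mn; rewrite -addSn leq_add2r.
Qed.

Lemma agree_wreath n a b e : (forall x, agree n (a x) (b x)) ->
  agree n.+1 (wreath a e) (wreath b e).
Proof.
by move=> ab [|x w] wn; rewrite ?label_wreath0 ?label_wreath// ab.
Qed.

(** * Constrained groups of patterns of index two *)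

Section PatternSet.
Variables (k : nat) (Q : tree_aut -> Prop).
Hypothesis Q1 : Q 1%g.
Hypothesis QM : forall g h, Q g -> Q h -> Q (g * h)%g.
Hypothesis QV : forall g, Q g -> Q (g^-1)%g.
Hypothesis Qagree : forall g h, agree k.+2 g h -> Q g -> Q h.
Hypothesis Qess : forall g i, Q g ->
  exists2 h, Q h & agree k.+1 h (sec g [:: i]).

(** Here [Q] stands for the condition that the pattern of size [k + 2] at the root is allowed; by
    [Qagree] only that pattern matters. *)
Definition constrained (g : tree_aut) : Prop := forall w, Q (sec g w).

Lemma constrained1 : constrained 1%g.
Proof. by move=> w; rewrite sec1. Qed.

Lemma constrainedM g h : constrained g -> constrained h ->
  constrained (g * h)%g.
Proof. by move=> Kg Kh w; rewrite secM; apply: QM. Qed.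

Lemma constrainedV g : constrained g -> constrained (g^-1)%g.
Proof. by move=> Kg w; rewrite secV; apply: QV. Qed.

Lemma constrained_sec g w : constrained g -> constrained (sec g w).
Proof. by move=> Kg v; rewrite -sec_cat. Qed.

Lemma constrained_wreath a e : (forall x, constrained (a x)) -> Q (wreath a e) ->
  constrained (wreath a e).
Proof.
move=> Ka Qa [|x v]; first by rewrite sec0.
by rewrite -cat1s sec_cat sec_wreath; apply: Ka.
Qed.

(** Essentiality provides below each vertex an allowed pattern compatible with the one above it;
    iterating these choices fills the tree. *)
Lemma extend_pattern g : Q g -> exists2 g', constrained g' & agree k.+2 g g'.
Proof.
move=> Qg; have /choice[e eP] : forall gi : tree_aut * bool, exists h,
    Q gi.1 -> Q h /\ agree k.+1 h (sec gi.1 [:: gi.2]).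
  move=> [h i] /=; have [Qh|nQh] := pselect (Q h); last by exists 1%g.
  by have [h' Qh' hh'] := Qess i Qh; exists h'.
(* The allowed pattern chosen at [w], of which only the root label is kept. *)
pose E (h : tree_aut) w := foldl (fun h i => e (h, i)) h w.
have QE w h : Q h -> Q (E h w).
  by elim: w h => //= i w IH h Qh; apply: IH; have [] := eP (h, i) Qh.
(* Each choice keeps the first [k + 1] levels of the section, while the word still to be read loses
   a letter: the level that may change is never read. *)
have labE w h : Q h -> (size w < k.+2)%N -> label (E h w) [::] = label h w.
  elim: w h => //= i w IH h Qh wk; have [Qh' hh'] := eP (h, i) Qh.
  by rewrite /E/= -/(E _ w) IH ?hh'// ?label_sec// ltnW.
exists (aut_of_label (fun w => label (E g w) [::])).
  move=> w; apply: (@Qagree (E g w)); last exact: QE.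
  move=> v vk; rewrite label_sec label_aut_of_label /E foldl_cat.
  by rewrite -/(E g w) -/(E _ v) labE//; apply: QE.
by move=> w wk; rewrite label_aut_of_label labE.
Qed.

(** * Prescribing labels when the index in the level stabilizer is at most two *)

Hypothesis Qindex : forall a b, agree k.+1 1%g a -> agree k.+1 1%g b ->
  [\/ Q a, Q b | Q (a * b)%g].

Definition wreath_left (h : tree_aut) :=
  wreath (fun x => if x then 1%g else h) false.
Definition wreath_right (h : tree_aut) :=
  wreath (fun x => if x then h else 1%g) false.

Lemma agree_wreath_left n h : agree n 1%g h -> agree n.+1 1%g (wreath_left h).
Proof.
move=> nh [|[] w] wn; rewrite ?label1 ?label_wreath0 ?label_wreath ?label1//.
by rewrite -nh// label1.
Qed.

Lemma agree_wreath_right n h : agree n 1%g h -> agree n.+1 1%g (wreath_right h).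
Proof.
move=> nh [|[] w] wn; rewrite ?label1 ?label_wreath0 ?label_wreath ?label1//.
by rewrite -nh// label1.
Qed.

(** If some right-supported [b] lies outside [Q], then multiplying by it repairs any left-supported
    element outside [Q] without changing its left section; if there is no such [b], the right side
    works. *)
Lemma stab_section : exists i : bool, forall h, agree k 1%g h ->
  exists q, [/\ Q q, agree k.+1 1%g q & sec q [:: i] = h].
Proof.
have [allr|] := pselect (forall h, agree k 1%g h -> Q (wreath_right h)).
  exists true => h kh; exists (wreath_right h).
  by split; [exact: allr|exact: agree_wreath_right|rewrite sec_wreath].
move=> /existsNP[b /not_implyP[kb nQb]]; exists false => h kh.
have [Qh|nQh] := pselect (Q (wreath_left h)).
  exists (wreath_left h); split=> //; first exact: agree_wreath_left.
  by rewrite sec_wreath.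
exists (wreath_left h * wreath_right b)%g; split.
- by case: (Qindex (agree_wreath_left kh) (agree_wreath_right kb)).
- rewrite -[1%g]mulg1; apply: agreeM; first exact: agree_wreath_left.
  exact: agree_wreath_right.
- by rewrite wreathM sec_wreath /= mulg1.
Qed.

(* The element of V cap P of [stab_section] provides level k; passing to a section
   at a child moves the prescribed labels up by one level. *)
Lemma pattern_level j : (j <= k)%N -> forall l : seq bool -> bool, exists q,
  [/\ Q q, agree j 1%g q & forall w, size w = j -> label q w = l w].
Proof.
have [i iP] := stab_section => jk; rewrite -(subKn jk).
elim: (k - j)%N (leq_subr j k) => {j jk} [_ l|m IH mk l].
  have kl : agree k 1%g
      (aut_of_label (fun w => if size w == k then l w else false)).
    by move=> w wk; rewrite label1 label_aut_of_label ltn_eqF.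
  have [q [Qq kq qi]] := iP _ kl.
  have [h Qh hq] := Qess i Qq; exists h; rewrite subn0; split=> //.
    apply: (@agree_trans _ (sec q [:: i])); first by rewrite qi.
    exact/agree_sym/(agree_leq _ hq).
  by move=> w wk; rewrite hq ?wk// qi label_aut_of_label wk eqxx.
have kmE : (k - m)%N = (k - m.+1).+1 by rewrite subnS prednK// subn_gt0.
(* Dropping the first letter makes the section at [i], one level higher, carry the labels [l]. *)
have [q [Qq kq ql]] := IH (ltnW mk) (fun w => l (behead w)).
have [h Qh hq] := Qess i Qq; exists h; split=> //.
- move=> w wk; rewrite hq ?label_sec/= -?kq ?label1//; first by rewrite kmE.
  by rewrite (leq_trans wk)// (leq_trans (leq_subr _ _)).
- move=> w wk; rewrite hq ?label_sec/= ?ql//=; first by rewrite wk kmE.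
  by rewrite wk ltnS leq_subr.
Qed.

(** The labels are corrected level by level: the factor from [pattern_level] leaves the levels
    already treated unchanged. *)
Lemma pattern_above_last g : exists2 q, Q q & agree k.+1 g q.
Proof.
suff H j : (j <= k.+1)%N -> exists2 q, Q q & agree j g q by exact: H.
elim: j => [_|j IH jk]; first by exists 1%g.
have [p Qp jp] := IH (ltnW jk).
(* As [q] acts after [p], the correction needed at [w] has to be prescribed at [p w]. *)
have [q [Qq jq ql]] := pattern_level jk (fun u =>
  label p ((p^-1)%g u) (+) label g ((p^-1)%g u)).
exists (q * p)%g; first exact: QM.
move=> w; rewrite ltnS leq_eqVlt labelM => /predU1P[wj|wj].
  by rewrite ql ?size_tree_aut// tree_mulVE addbAC addbb.
by rewrite -jq ?size_tree_aut// label1 jp.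
Qed.

(** By [pattern_above_last], every element is the product of one in [Q] and one fixing level
    [k + 1]. *)
Lemma pattern_all : (forall a, agree k.+1 1%g a -> Q a) -> forall g, Q g.
Proof.
move=> QS g; have [q Qq gq] := pattern_above_last g.
rewrite -(mulKVg q g); apply: QM => //; apply: QS.
by rewrite -(mulVg q); apply: agreeM => //; apply: agree_sym.
Qed.

(** * The character with kernel [Q] and its wreath decomposition *)

Definition parity (g : tree_aut) : bool := ~~ `[< Q g >].

Lemma parityM g h : parity (g * h)%g = parity g (+) parity h.
Proof.
have QMl a b : Q a -> `[< Q (a * b)%g >] = `[< Q b >].
  move=> Qa; apply/asbool_equiv_eq; split=> [Qab|]; last exact: QM.
  by rewrite -(mulKg a b); apply: QM => //; apply: QV.
have QMr a b : Q b -> `[< Q (a * b)%g >] = `[< Q a >].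
  move=> Qb; apply/asbool_equiv_eq; split=> [Qab|Qa]; last exact: QM.
  by rewrite -(mulgK b a); apply: QM => //; apply: QV.
rewrite /parity; case: (asboolP (Q g)) => [/QMl ->//|nQg].
case: (asboolP (Q h)) => [/QMr ->/=|nQh]; first by case: asboolP.
apply/negbF/asboolP.
(* Factors from [Q] move [g] and [h] into the stabilizer of level [k + 1], where [Qindex]
   applies. *)
have [p Qp gp] := pattern_above_last g; have [q Qq hq] := pattern_above_last h.
have ga : agree k.+1 1%g (p^-1 * g)%g.
  by rewrite -(mulVg p); apply: agreeM => //; apply: agree_sym.
have hb : agree k.+1 1%g (h * q^-1)%g.
  by rewrite -(mulgV q); apply: agreeM => //; apply: agree_sym.
have -> : (g * h = p * ((p^-1 * g) * (h * q^-1)) * q)%g.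
  by rewrite !mulgA mulgV mul1g mulgKV.
apply: QM => //; apply: QM => //; case: (Qindex ga hb) => // [Qa|Qb].
  by case: nQg; rewrite -(mulKVg p g); apply: QM.
by case: nQh; rewrite -(mulgKV q h); apply: QM.
Qed.

Lemma parity_agree g h : agree k.+2 g h -> parity g = parity h.
Proof.
move=> gh; congr negb; apply/asbool_equiv_eq.
by split; apply: Qagree => //; apply: agree_sym.
Qed.

Lemma parityP g : Q g <-> parity g = false.
Proof. by rewrite /parity; case: asboolP. Qed.

(** The homomorphism chi' and the coefficient c in the decomposition of chi. *)
Definition parity_left (h : tree_aut) : bool := parity (wreath_left h).
Definition parity_swap : bool := parity (wreath (fun=> 1%g) true).

Lemma parity1 : parity 1%g = false.
Proof. exact/parityP. Qed.

Lemma parity_leftM g h :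
  parity_left (g * h)%g = parity_left g (+) parity_left h.
Proof.
rewrite /parity_left -parityM wreathM; congr parity; apply: eq_wreath => -[]//=.
by rewrite mulg1.
Qed.

Lemma parity_left1 : parity_left 1%g = false.
Proof.
rewrite /parity_left -[RHS]parity1 -[in RHS]wreath1; congr parity.
by apply: eq_wreath => -[].
Qed.

Lemma parity_left_agree g h : agree k.+1 g h -> parity_left g = parity_left h.
Proof. by move=> gh; apply/parity_agree/agree_wreath => -[]. Qed.

(** The root swap conjugates left-supported elements into right-supported ones, and a homomorphism
    to Z/2 is invariant under conjugation. *)
Lemma parity_right h : parity (wreath_right h) = parity_left h.
Proof.
have -> : wreath_right h =
    (wreath (fun=> 1) true * wreath_left h * wreath (fun=> 1) true)%g.
  by rewrite !wreathM; apply: eq_wreath => -[] /=; rewrite !(mul1g, mulg1).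
by rewrite !parityM addbC addbA addbb.
Qed.

Lemma parity_wreath g : parity g =
  parity_left (sec g [:: false]) (+) parity_left (sec g [:: true]) (+)
  (parity_swap && label g [::]).
Proof.
have gE : g = (wreath (fun=> 1) (label g [::]) *
    (wreath_left (sec g [:: false]) * wreath_right (sec g [:: true])))%g.
  rewrite !wreathM [LHS]wreath_sec /= !addbF; apply: eq_wreath => -[] /=;
  by rewrite !(mul1g, mulg1).
rewrite [in LHS]gE !parityM parity_right addbC; congr (_ (+) _).
by case: label; rewrite ?andbT// andbF wreath1 parity1.
Qed.

(* Modulo 4, [b (+) c] is [b + c + 2 b c]: on [constrained], the additivity defects
   of the root label and of [parity_left] of the left section cancel. *)
Definition root_hom (g : tree_aut) : 'Z_4 :=
  ((parity_swap && label g [::])%:R + (parity_left (sec g [:: false]))%:R *+ 2)%R.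

Lemma parity_left_sec g : constrained g ->
  parity_left (sec g [:: false]) =
  parity_left (sec g [:: true]) (+) (parity_swap && label g [::]).
Proof.
move=> /(_ [::]); rewrite sec0 => /parityP; rewrite parity_wreath.
by case: parity_left; case: parity_left; case: (_ && _).
Qed.

Lemma root_homM g h : constrained g -> constrained h ->
  root_hom (g * h)%g = (root_hom g + root_hom h)%R.
Proof.
move=> /parity_left_sec gE _.
rewrite /root_hom secM parity_leftM labelM tree_aut_nil.
rewrite tree_aut1 addFb.
(* If [h] swaps at the root, the right section of [g] enters. Replacing it by the left one costs c
   times the root label of [g]; doubled, this is the carry in adding the root labels modulo 4. *)
have -> : parity_left (sec g [:: label h [::]]) =
    parity_left (sec g [:: false]) (+)
    (parity_swap && label g [::] && label h [::]).
  case: (label h _); last by rewrite andbF addbF.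
  by rewrite andbT gE -addbA addbb addbF.
move: (parity_left (sec g _)) (parity_left (sec h _)) => a b.
by case: parity_swap; case: (label g _); case: (label h _); case: a; case: b;
  apply/val_inj.
Qed.

(** * Homomorphisms to Z/4, one for each level *)

Fixpoint level_hom (n : nat) (g : tree_aut) : 'Z_4 :=
  if n is m.+1 then
    (level_hom m (sec g [:: false]) + level_hom m (sec g [:: true]))%R
  else root_hom g.

Lemma level_homM n g h : constrained g -> constrained h ->
  level_hom n (g * h)%g = (level_hom n g + level_hom n h)%R.
Proof.
elim: n g h => [|n IH] g h Kg Kh; first exact: root_homM.
rewrite /= !secM !tree_aut1 !IH ?addFb ?addTb;
  do ?exact: constrained_sec.
(* A root swap in [h] only permutes the two summands coming from [g]. *)
by case: (label h _); rewrite addrACA// [X in (X + _)%R]addrC.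
Qed.

Lemma level_hom1 n : level_hom n 1%g = 0%R.
Proof.
elim: n => [|n IH]; last by rewrite /= !sec1 IH addr0.
by rewrite /= /root_hom label1 sec1 parity_left1 andbF; apply/val_inj.
Qed.

Lemma level_homV n g : constrained g ->
  level_hom n (g^-1)%g = (- level_hom n g)%R.
Proof.
move=> Kg; apply/eqP; rewrite -addr_eq0 -level_homM ?mulVg ?level_hom1//.
exact: constrainedV.
Qed.

(** This is the continuity of [level_hom n]. *)
Lemma level_hom_agree n g h : agree (n + k.+2) g h ->
  level_hom n g = level_hom n h.
Proof.
elim: n g h => [|n IH] g h gh; last first.
  have ghi i : agree (n + k.+2) (sec g [:: i]) (sec h [:: i]).
    by apply: agree_sec gh; rewrite addn1.
  by rewrite /= (IH _ _ (ghi false)) (IH _ _ (ghi true)).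
rewrite /= /root_hom gh// (@parity_left_agree _ (sec h [:: false]))//.
by apply: agree_sec gh; rewrite addn1.
Qed.

Variable tau : tree_aut.
Hypothesis tau_stab : agree k.+1 1%g tau.
Hypothesis nQtau : ~ Q tau.

(** As [tau] is odd with trivial root label, one of its sections [h] has odd [parity_left]. The
    element with both sections [h] is even, so it extends to a constrained element, on which
    [root_hom] is 2. *)
Lemma root_hom_nontrivial :
  exists g, [/\ constrained g, agree k.+1 1%g g & root_hom g != 0%R].
Proof.
have : parity tau by apply/negP => /asboolP.
rewrite parity_wreath -tau_stab// label1 andbF addbF => tau_odd.
have [h kh oh] : exists2 h, agree k 1%g h & parity_left h.
  have S i : agree k 1%g (sec tau [:: i]).
    by rewrite -(sec1 [:: i]); apply: agree_sec tau_stab; rewrite addn1.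
  case: (boolP (parity_left (sec tau [:: false]))) => [?|/negbTE o0].
    by exists (sec tau [:: false]).
  by exists (sec tau [:: true]) => //; rewrite o0 in tau_odd.
have Qhh : Q (wreath (fun=> h) false).
  by apply/parityP; rewrite parity_wreath !sec_wreath label_wreath0 addbb andbF.
have hhS : agree k.+1 1%g (wreath (fun=> h) false).
  by rewrite -wreath1; apply: agree_wreath.
have [g Kg hg] := extend_pattern Qhh; exists g; split=> //.
  by apply: agree_trans hhS (agree_leq _ hg).
rewrite /root_hom -hg// label_wreath0 andbF add0r -(@parity_left_agree h) ?oh//.
by rewrite -(sec_wreath (fun=> h) false false); apply: agree_sec hg; rewrite addn1.
Qed.

Lemma constrained_wreath_left n g : constrained g -> agree (n + k.+1) 1%g g ->
  constrained (wreath_left g) /\ agree (n.+1 + k.+1) 1%g (wreath_left g).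
Proof.
move=> Kg ng; have S := agree_wreath_left ng; split=> //.
apply: constrained_wreath => [[]//|]; first exact: constrained1.
by apply: Qagree Q1; apply: agree_leq S; rewrite ltnS leq_addl.
Qed.

(** Moving an element into the left subtree shifts its sequence of values by one place, so a nonzero
    value of [root_hom] can be pushed to any level [m]. *)
Lemma level_hom_separated m : exists g, [/\ constrained g, agree (m + k.+1) 1%g g,
  level_hom m g != 0%R & forall n, (n < m)%N -> level_hom n g = 0%R].
Proof.
elim: m => [|m [g [Kg mg bg b0]]].
  by have [g [Kg kg ag]] := root_hom_nontrivial; exists g.
have [Kw mw] := constrained_wreath_left Kg mg; exists (wreath_left g); split=> //.
  by rewrite /= !sec_wreath level_hom1 addr0.
move=> [_|n nm]; last by rewrite /= !sec_wreath level_hom1 addr0 b0.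
rewrite /= /root_hom label_wreath0 andbF add0r sec_wreath.
(* The shifted element has trivial pattern at the root, so the new value at level 0 vanishes. *)
have -> : parity_left g = false; last by rewrite mul0rn.
apply/parityP/Qagree/Q1; apply: agree_leq mw.
by rewrite ltnS leq_addl.
Qed.

(** By pigeonhole, two of these homomorphisms agree on [S], hence on the subgroup it generates; by
    continuity that subgroup misses a neighbourhood of an element separating them. *)
Lemma not_dense_fg (S : set tree_aut) : finite_set S ->
  (forall g, S g -> constrained g) ->
  exists g n, constrained g /\ forall h, gen_subgroup S h -> ~ agree n g h.
Proof.
move=> /finite_seqP[s sE] SK.
(* One more homomorphism than there are tuples of values in Z/4 on the generators. *)
pose vec (n : 'I_(4 ^ size s).+1) : (size s).-tuple 'Z_4 :=
  [tuple of map_tuple (level_hom n) (in_tuple s)].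
have [n [m [nm vnm]]] : exists n m : nat,
    (n < m)%N /\ forall g, S g -> level_hom n g = level_hom m g.
  apply: contrapT => nex; suff /leq_card : injective vec.
    by rewrite card_tuple !card_ord ltnn.
  have vecS (n m : 'I_(4 ^ size s).+1) : vec n = vec m ->
      forall g, S g -> level_hom n g = level_hom m g.
    move=> /(congr1 val)/= /eq_in_map vnm g; rewrite sE => gs.
    exact: vnm.
  move=> n m vnm; apply: val_inj; case: (ltngtP n m) => // nm; case: nex.
    by exists n, m; split=> //; apply: vecS.
  by exists m, n; split=> //; apply: vecS.
have [g [Kg _ mg ng]] := level_hom_separated m.
exists g, (m + k.+2)%N; split=> // h Sh gh.
suff [_ hnm] : constrained h /\ level_hom n h = level_hom m h.
  move: mg; rewrite (level_hom_agree gh) -hnm -(@level_hom_agree n g) ?ng ?eqxx//.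
  by apply: agree_leq gh; rewrite leq_add2r ltnW.
pose H := [set h | constrained h /\ level_hom n h = level_hom m h]%classic.
move: Sh => /(_ H); apply; split.
  split=> [|a b]; rewrite /H ?inE/=.
    by split; [exact: constrained1|rewrite !level_hom1].
  move=> [Ka abE] [Kb bbE]; split.
    by apply: constrainedM => //; apply: constrainedV.
  have KV := constrainedV Kb.
  by rewrite !level_homM// !level_homV// abE bbE.
by move=> a Sa /=; split; [exact: SK|exact: vnm].
Qed.
End PatternSet.

(** * Patterns and coverings of the constrained group *)

Section Trunc.
Variable d : nat.
Implicit Types (p q : {perm d.-bseq bool}).

Lemma insub_bseqK (w : seq bool) :
  (size w <= d)%N -> insub_bseq d w = w :> seq bool.
Proof. by move=> wd; rewrite /insub_bseq insubdK. Qed.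

Lemma insub_bseq_val (u : d.-bseq bool) : insub_bseq d u = u.
Proof. by apply: val_inj; rewrite /= insub_bseqK// size_bseq. Qed.

Lemma trunc_aut_tree p : p \in trunc_aut d ->
  exists g : tree_aut, forall w, (size w <= d)%N -> trunc_fun p w = g w.
Proof.
rewrite inE => /andP[/eqP p0 /forallP pc].
have step w x : (size w < d)%N ->
    exists y, trunc_fun p (rcons w x) = rcons (trunc_fun p w) y.
  move=> wd.
  have /forallP/(_ (insub_bseq d (rcons w x)))/eqP := pc (insub_bseq d w).
  rewrite !insub_bseqK ?size_rcons// 1?ltnW// => pcE.
  have : child w (rcons w x) by apply/existsP; exists x.
  by rewrite -pcE => /existsP[y /eqP yE]; exists y.
have pinj u v : (size u <= d)%N -> (size v <= d)%N ->
    trunc_fun p u = trunc_fun p v -> u = v.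
  move=> ud vd /val_inj/perm_inj/(congr1 val).
  by rewrite /= !insub_bseqK.
have p_nil : trunc_fun p [::] = [::].
  have -> : trunc_fun p [::] = p [bseq]; last by rewrite p0.
  by congr (val (p _)); apply: val_inj; rewrite /= insub_bseqK.
(* The label at [w] is the last letter of the image of [rcons w false]; below the truncation the
   values are arbitrary. *)
exists (aut_of_label (fun w => last false (trunc_fun p (rcons w false)))).
elim/last_ind => [_|w x IH]; first by rewrite tree_aut_nil.
rewrite size_rcons => wd; have {IH} := IH (ltnW wd) => IH.
rewrite tree_aut_label label_aut_of_label -IH.
have [y0 y0E] := step w false wd; have [y1 y1E] := step w true wd.
have ne : y0 != y1.
  apply/eqP => y01; have /rcons_inj2// : rcons w false = rcons w true.
  by apply: pinj; rewrite ?size_rcons// y0E y1E y01.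
rewrite y0E last_rcons.
by case: x; rewrite ?y0E ?y1E; case: y0 y1 ne {y0E y1E} => -[].
Qed.

Definition same_action p (g : tree_aut) : Prop :=
  forall w, (size w <= d)%N -> trunc_fun p w = g w.

Lemma same_action_label p (g : tree_aut) : same_action p g ->
  forall w, (size w < d)%N -> trunc_label p w = label g w.
Proof.
move=> pg w wd; rewrite /trunc_label /label /section.
by rewrite !pg ?size_cat ?addn1.
Qed.

Lemma label_same_action p (g : tree_aut) : p \in trunc_aut d ->
  (forall w, (size w < d)%N -> trunc_label p w = label g w) -> same_action p g.
Proof.
move=> /trunc_aut_tree[h ph] pg w wd; rewrite ph//.
by apply: agreeE wd => v vd; rewrite -pg// -(same_action_label ph).
Qed.

Variable P : {group {perm d.-bseq bool}}.
Hypothesis hP : (P \subset trunc_aut d)%g.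

(** The instance of [Q] given by [P], with [d = k + 2]. *)
Definition root_pattern (g : tree_aut) : Prop :=
  exists2 p, p \in P & same_action p g.

Lemma root_pattern1 : root_pattern 1%g.
Proof.
exists 1%g => [|w wd]; first exact: group1.
by rewrite /trunc_fun perm1 insub_bseqK.
Qed.

Lemma root_patternM g h : root_pattern g -> root_pattern h ->
  root_pattern (g * h)%g.
Proof.
(* Permutations compose from left to right, so the pattern [p] of [h] comes first in the product. *)
move=> [q qP qg] [p pP ph]; exists (p * q)%g; first exact: groupM.
move=> w wd; rewrite tree_mulE -ph// -qg ?size_bseq//.
by rewrite /trunc_fun permM insub_bseq_val.
Qed.

Lemma root_patternV g : root_pattern g -> root_pattern (g^-1)%g.
Proof.
move=> [p pP pg]; exists (p^-1)%g => [|w wd]; first by rewrite groupV.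
have ud : (size ((g^-1)%g w) <= d)%N by rewrite size_tree_aut.
rewrite -[in LHS](tree_mulEV g w) -pg// /trunc_fun insub_bseq_val permK.
by rewrite insub_bseqK.
Qed.

Lemma root_pattern_agree g h : agree d g h -> root_pattern g -> root_pattern h.
Proof.
by move=> gh [p pP pg]; exists p => // w wd; rewrite pg// (agreeE gh).
Qed.

Lemma root_pattern_ess : essential P -> forall g i, root_pattern g ->
  exists2 h, root_pattern h & agree d.-1 h (sec g [:: i]).
Proof.
move=> ess g i [p pP pg]; have [q qP qp] := ess p pP i.
have [h qh] := trunc_aut_tree (fintype.subsetP hP _ qP).
exists h; first by exists q.
move=> w wd; rewrite label_sec -(same_action_label qh).
  by rewrite qp// (same_action_label pg)//= -ltn_predRL.
by rewrite (leq_trans wd)// leq_pred.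
Qed.

Lemma fin_constrainedE g :
  fin_constrained P g <-> constrained root_pattern g.
Proof.
split=> Kg w; have [p pP pg] := Kg w; exists p => //.
  apply: label_same_action; first exact: (fintype.subsetP hP).
  by move=> v vd; rewrite pg// label_sec.
by move=> v vd; rewrite (same_action_label pg)// label_sec.
Qed.

End Trunc.

(** * Counting cylinders when the index is at least four *)

Section Covering.
Variables (k : nat) (Q : tree_aut -> Prop).
Hypothesis QM : forall g h, Q g -> Q h -> Q (g * h)%g.
Hypothesis QV : forall g, Q g -> Q (g^-1)%g.
Hypothesis Qagree : forall g h, agree k.+2 g h -> Q g -> Q h.

Variables a b : tree_aut.
Hypotheses (sa : agree k.+1 1%g a) (sb : agree k.+1 1%g b).
Hypotheses (nQa : ~ Q a) (nQb : ~ Q b) (nQab : ~ Q (a * b)%g).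

Lemma label_mul_stab g u w : agree k.+1 1%g u -> (size w < k.+2)%N ->
  label (g * u)%g w = label g w (+) label u w.
Proof.
by move=> su wk; rewrite labelM -(agreeE su).
Qed.

(** Of the [2 ^ (2 ^ k.+1)] labelings of level [k + 1], at most a quarter continue given labels
    above it, because of the index at least 4. *)
Lemma pattern_extensions g0 : exists2 L : seq tree_aut,
  (size L <= 2 ^ (2 ^ k.+1 - 2))%N &
  forall g, Q g -> agree k.+1 g0 g -> exists2 h, h \in L & agree k.+2 h g.
Proof.
pose F := {ffun k.+1.-tuple bool -> bool}.
pose ext (f : F) g := [/\ Q g, agree k.+1 g0 g &
  forall t : k.+1.-tuple bool, label g t = f t].
pose X : {set F} := [set f | `[< exists g, ext f g >]].
have /choice[r rP] : forall f, exists g, (exists g, ext f g) -> ext f g.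
  by move=> f; have [[g ?]|] := pselect (exists g, ext f g); [exists g|exists 1%g].
have XP f : f \in X -> ext f (r f) by rewrite inE => /asboolP/rP.
exists [seq r f | f <- enum X]; last first.
  move=> g Qg g0g; pose f : F := [ffun t : k.+1.-tuple bool => label g t].
  have fX : f \in X.
    by rewrite inE; apply/asboolP; exists g; split=> // t; rewrite ffunE.
  exists (r f); first by rewrite map_f// mem_enum.
  have [_ rk rf] := XP _ fX => w; rewrite ltnS leq_eqVlt => /predU1P[/eqP wk|wk].
    by have := rf (Tuple wk); rewrite ffunE.
  by rewrite -rk// g0g.
rewrite size_map -cardE.
pose e2 (s : bool) (c : tree_aut) : tree_aut := if s then c else 1%g.
pose u s t : tree_aut := (e2 s a * e2 t b)%g.
have su s t : agree k.+1 1%g (u s t).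
  rewrite -[1%g]mulg1; apply: agreeM; first by case: s.
  by case: t.
have lu s t w : (size w < k.+2)%N ->
    label (u s t) w = (s && label a w) (+) (t && label b w).
  move=> wk; rewrite label_mul_stab//; last by case: (t).
  by case: s; case: t; rewrite ?label1.
have Qu s t : Q (u s t) -> (s = false) * (t = false).
  by case: s; case: t; rewrite /u /e2 ?mulg1 ?mul1g.
(* As 1, a, b and ab lie in distinct cosets of [Q], the translates by their
   labels of the set of extensions are disjoint. *)
pose G (x : F * (bool * bool)) : F :=
  [ffun w => x.1 w (+) (x.2.1 && label a w) (+) (x.2.2 && label b w)].
have Ginj : {in finset.setX X [set: bool * bool]%SET &, injective G}.
  move=> [f [s t]] [f' [s' t']]; rewrite !finset.in_setX !finset.in_setT !andbT /=.
  move=> /XP[Qg gk gf] /XP[Qg' gk' gf'] /ffunP GE.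
  have gg' : agree k.+2 (r f * u (s (+) s') (t (+) t'))%g (r f').
    move=> w wk; rewrite label_mul_stab// lu//.
    move: wk; rewrite ltnS leq_eqVlt => /predU1P[/eqP wk|wk]; last first.
      by rewrite -sa// -sb// label1 !andbF !addbF -gk// gk'.
    move: (GE (Tuple wk)) => {GE}; rewrite !ffunE -gf -gf' /=.
    case: (label a w); case: (label b w); case: s; case: t; case: s'; case: t';
    move=> //=;
    by case: (label _ w); case: (label _ w).
  have [] : (s (+) s' = false) * (t (+) t' = false).
    apply: Qu; rewrite -(mulKg (r f) (u _ _)); apply: QM; first exact: QV.
    by apply: Qagree Qg'; apply: agree_sym.
  have addI (x y : bool) : x (+) y = false -> y = x by case: x; case: y.
  move=> /addI ss /addI tt; subst s' t'; congr (_, _); apply/ffunP => w.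
  have := GE w; rewrite !ffunE /=.
  by case: (f w); case: (f' w); case: (_ && _); case: (_ && _).
have : (#|X| * 4 <= 2 ^ (2 ^ k.+1))%N.
  have -> : (#|X| * 4 = #|finset.setX X [set: bool * bool]%SET|)%N.
    by rewrite finset.cardsX finset.cardsT card_prod card_bool.
  rewrite -(card_in_imset Ginj) (leq_trans (max_card _))//.
  by rewrite card_ffun card_tuple card_bool.
have {1}<- : (2 ^ k.+1 - 2 + 2 = 2 ^ k.+1)%N.
  by rewrite subnK// -{1}(expn1 2) leq_exp2l.
by rewrite expnD leq_mul2r.
Qed.

(** Extend the root pattern by one level, then cover both sections recursively; each of the
    [2 ^ m - 1] vertices on the first [m] levels contributes one factor from
    [pattern_extensions]. *)
Lemma constrained_cover_from m g0 : exists2 L : seq tree_aut,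
  (size L <= 2 ^ ((2 ^ k.+1 - 2) * (2 ^ m - 1)))%N &
  forall g, constrained Q g -> agree k.+1 g0 g ->
    exists2 h, h \in L & agree (k.+1 + m) h g.
Proof.
elim: m g0 => [|m IH] g0.
  exists [:: g0] => [|g _ g0g]; first by rewrite subnn muln0.
  by exists g0; rewrite ?mem_head// addn0.
have {IH}/choice[Lm LmP] : forall g0, exists L : seq tree_aut,
    (size L <= 2 ^ ((2 ^ k.+1 - 2) * (2 ^ m - 1)))%N /\
    forall g, constrained Q g -> agree k.+1 g0 g ->
      exists2 h, h \in L & agree (k.+1 + m) h g.
  by move=> g; have [L ? ?] := IH g; exists L.
have [L sL LP] := pattern_extensions g0.
pose wr2 e (h0 h1 : tree_aut) := wreath (fun x => if x then h1 else h0) e.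
pose step (p : tree_aut) := [seq wr2 (label p [::]) h0 h1 |
  h0 <- Lm (sec p [:: false]), h1 <- Lm (sec p [:: true])].
exists (flatten [seq step p | p <- L]).
  have -> : (2 ^ m.+1 - 1 = 1 + ((2 ^ m - 1) + (2 ^ m - 1)))%N.
    have : (0 < 2 ^ m)%N by rewrite expn_gt0.
    by rewrite expnS; case: (2 ^ m)%N => // j _; rewrite mul2n -addnn addnS !subn1.
  rewrite mulnDr muln1 expnD mulnDr expnD; set K := (2 ^ (_ * (2 ^ m - 1)))%N.
  rewrite (leq_trans _ (leq_mul sL (leqnn (K * K)%N)))//.
  elim: L {sL LP} => //= p L IHL; rewrite size_cat mulSn leq_add//.
  by rewrite size_allpairs leq_mul//; apply: (LmP _).1.
move=> g Kg g0g; have Qg : Q g by rewrite -(sec0 g); apply: Kg.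
have [p pL pg] := LP g Qg g0g.
have pgi i : agree k.+1 (sec p [:: i]) (sec g [:: i]).
  by apply: agree_sec pg; rewrite addn1.
have [h0 h0L h0g] := (LmP _).2 _ (constrained_sec [:: false] Kg) (pgi false).
have [h1 h1L h1g] := (LmP _).2 _ (constrained_sec [:: true] Kg) (pgi true).
exists (wr2 (label p [::]) h0 h1).
  apply/flattenP; exists (step p); first exact: map_f.
  exact: allpairs_f.
by rewrite (wreath_sec g) -pg// addnS; apply: agree_wreath => -[].
Qed.

Lemma constrained_cover : exists C : nat, forall m, exists2 L : seq tree_aut,
  (size L <= C * 2 ^ ((2 ^ k.+1 - 2) * (2 ^ m - 1)))%N &
  forall g, constrained Q g -> exists2 h, h \in L & agree (k.+1 + m) h g.
Proof.
pose F := {ffun k.-bseq bool -> bool}.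
(* The constant counts all labelings of the first [k + 1] levels. *)
exists #|F| => m.
pose top (f : F) := aut_of_label (fun w => f (insub_bseq k w)).
have /choice[Lm LmP] : forall g0, exists L : seq tree_aut,
    (size L <= 2 ^ ((2 ^ k.+1 - 2) * (2 ^ m - 1)))%N /\
    forall g, constrained Q g -> agree k.+1 g0 g ->
      exists2 h, h \in L & agree (k.+1 + m) h g.
  by move=> g; have [L ? ?] := constrained_cover_from m g; exists L.
exists (flatten [seq Lm (top f) | f <- enum F]).
  rewrite cardE; elim: (enum F) => //= f s IH.
  by rewrite size_cat mulSn leq_add//; apply: (LmP _).1.
move=> g Kg; pose f : F := [ffun w : k.-bseq bool => label g w].
have fg : agree k.+1 (top f) g.
  by move=> w wk; rewrite label_aut_of_label ffunE insub_bseqK.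
have [h hL hg] := (LmP _).2 _ Kg fg; exists h => //.
by apply/flattenP; exists (Lm (top f)) => //; apply: map_f; rewrite mem_enum.
Qed.

End Covering.

(** * The metric and Hausdorff measures *)

Import Order.TTheory Num.Theory.
Local Open Scope classical_set_scope.

(* The breadth-first numbering of the vertices, starting from 0 at the root. *)
Definition heap_index (w : seq bool) : nat :=
  (foldl (fun (c : nat) (x : bool) => c.*2 + x) 1 w).-1.

Lemma heap_index_rcons w x : heap_index (rcons w x) = ((heap_index w).*2 + x).+1.
Proof.
rewrite /heap_index foldl_rcons.
have : (0 < foldl (fun c (x : bool) => c.*2 + x) 1 w)%N.
  elim/last_ind: w => // w y IH; rewrite foldl_rcons addn_gt0 double_gt0.
  by rewrite IH.
by case: (foldl _ _ _).
Qed.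

Lemma heap_index_inj : injective heap_index.
Proof.
elim/last_ind => [|u x IH] v; case/lastP: v => [|v y]; rewrite ?heap_index_rcons//.
move=> [uvE]; have xy : x = y.
  by have := congr1 odd uvE; rewrite !oddD !odd_double !oddb.
by subst y; congr rcons; apply/IH/double_inj/eqP; rewrite -(eqn_add2r x) uvE.
Qed.

Lemma heap_index_surj i : exists w, heap_index w = i.
Proof.
elim/ltn_ind: i => -[|i] IH; first by exists [::].
have [|w wE] := IH i./2.
  by rewrite ltnS leq_half_double -addnn -addnS leq_addr.
by exists (rcons w (odd i)); rewrite heap_index_rcons wE addnC odd_double_half.
Qed.

Lemma heap_index_lt n w : (heap_index w < 2 ^ n - 1)%N = (size w < n)%N.
Proof.
elim/last_ind: w n => [|w x IH] [|n]; rewrite ?subnn//.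
  by rewrite subn_gt0 -{1}(expn0 2) ltn_exp2l.
rewrite heap_index_rcons size_rcons ltnS -IH.
rewrite expnS mul2n; have : (0 < 2 ^ n)%N by rewrite expn_gt0.
case: (2 ^ n)%N => // m _; rewrite doubleS !subn1 /= ltnS.
by case: x; rewrite ?addn1 ?addn0 ?ltn_Sdouble ?ltn_double.
Qed.

Lemma level_coset_agree n g : level_coset n g = [set h : tree_aut | agree n g h].
Proof.
rewrite level_cosetE; apply/seteqP; split=> h /= gh; last first.
  by move=> u un; rewrite (agreeE gh) ?un.
apply: agreeP => w wn; have := gh (w ++ nseq (n - size w) false).
rewrite size_cat size_nseq subnKC// => /(_ erefl) /(congr1 (take (size w))).
by rewrite !tree_aut_cat !take_size_cat ?size_tree_aut.
Qed.

(** Cosets correspond to free choices of labels at the vertices above level [n], which [heap_index]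
    numbers by the integers below [2 ^ n - 1]. *)
Lemma level_index n :
  subgroup_index setT (level_stab n) = (2 ^ (2 ^ n - 1))%N.
Proof.
pose F := {ffun 'I_(2 ^ n - 1) -> bool}.
pose lab (r : F) w := odflt false (omap r (insub (heap_index w))).
have labE r w (wn : (heap_index w < 2 ^ n - 1)%N) : lab r w = r (Ordinal wn).
  by rewrite /lab insubT.
pose Phi (r : F) : set tree_aut := level_coset n (aut_of_label (lab r)).
have PhiE r : Phi r = [set h | forall w, (size w < n)%N -> lab r w = label h w].
  rewrite /Phi level_coset_agree; apply/seteqP.
  by split=> h /= hr w wn; have := hr w wn; rewrite label_aut_of_label.
rewrite /subgroup_index.
have -> : [set [set h * k | k in level_stab n]%g | h in setT] = Phi @` setT.
  apply/seteqP; split=> [_ [g _ <-]|_ [r _ <-]]; last first.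
    by exists (aut_of_label (lab r)).
  pose sw (i : 'I_(2 ^ n - 1)) := projT1 (cid (heap_index_surj i)).
  exists [ffun i => label g (sw i)] => //.
  rewrite PhiE -/(level_coset n g) level_coset_agree.
  have E w : (size w < n)%N -> lab [ffun i => label g (sw i)] w = label g w.
    rewrite -heap_index_lt => wn; rewrite labE ffunE /sw.
    by case: cid => u /= /heap_index_inj ->.
  by apply/seteqP; split=> h /= gh w wn; rewrite -gh// E.
have inj : injective Phi.
  move=> r r' rr'; have : Phi r (aut_of_label (lab r)).
    by rewrite PhiE => w _; rewrite label_aut_of_label.
  rewrite rr' PhiE => E; apply/ffunP => i.
  have [w wi] := heap_index_surj i.
  have wn : (heap_index w < 2 ^ n - 1)%N by rewrite wi.
  have := E w; rewrite -heap_index_lt => /(_ wn); rewrite label_aut_of_label !labE.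
  by have -> : Ordinal wn = i by apply: val_inj.
apply: card_fset_set.
have -> : (2 ^ (2 ^ n - 1))%N = #|F| by rewrite card_ffun card_bool card_ord.
apply: (@card_eq_trans _ _ _ _ [set: F]).
  by apply: inj_card_eq => ? ? _ _; apply: inj.
have -> : [set: F] = [set` [fset f in F]%fset].
  by apply/seteqP; split=> f //= _; rewrite !inE.
by apply/card_eq_fsetP; rewrite card_finset.
Qed.

Local Open Scope ring_scope.

Section Metric.
Variable R : realType.
Implicit Types g h : tree_aut.

Definition radius (n : nat) : R := ((2 ^ (2 ^ n - 1))%N%:R)^-1.

Lemma radius_gt0 n : 0 < radius n.
Proof. by rewrite invr_gt0 ltr0n expn_gt0. Qed.

Lemma radius_le m n : (m <= n)%N -> radius n <= radius m.
Proof.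
move=> mn; rewrite lef_pV2 ?posrE ?ltr0n ?expn_gt0// ler_nat leq_exp2l//.
by rewrite leq_sub2r// leq_exp2l.
Qed.

Lemma radius_ge n : radius n.+1 <= n.+1%:R^-1.
Proof.
rewrite lef_pV2 ?posrE ?ltr0n ?expn_gt0// ler_nat.
have n1 : (n.+1 <= 2 ^ n.+1 - 1)%N.
  by rewrite leq_subRL ?expn_gt0// add1n ltn_expl.
by rewrite (leq_trans n1)// ltnW// ltn_expl.
Qed.

Lemma tree_distE g h : g != h ->
  exists n, agree n g h /\ tree_dist R g h = radius n.
Proof.
move=> gh; have [_ gmin] := first_diffP gh.
exists (Defs.first_diff g h); split.
  move=> w wn; apply/eqP/negPn/negP => lw.
  by have := gmin _ (ex_intro2 _ _ w erefl lw); rewrite leqNgt wn.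
by rewrite /tree_dist (negbTE gh) level_index.
Qed.

Lemma tree_dist_le n g h : agree n g h -> tree_dist R g h <= radius n.
Proof.
rewrite /tree_dist; case: eqVneq => [_ _|gh ngh]; first exact/ltW/radius_gt0.
rewrite level_index; apply: radius_le; rewrite leqNgt; apply/negP => fn.
by have [[w wf /eqP]] := first_diffP gh; rewrite ngh ?wf.
Qed.

Lemma tree_dist_agree n g h : tree_dist R g h < radius n -> agree n g h.
Proof.
have [<- //|gh] := eqVneq g h.
have [m [mgh ->]] := tree_distE gh; rewrite ltNge => /negP mn.
by apply: agree_leq mgh; rewrite leqNgt; apply/negP => /ltnW/radius_le.
Qed.

Lemma mdist_tree g h : mdist (g : metric_tree_aut R) h = tree_dist R g h.
Proof. by []. Qed.

Lemma closure_agree (A : set tree_aut) g n :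
  closure (A : set (metric_tree_aut R)) g -> exists2 h, A h & agree n g h.
Proof.
move=> /(_ (ball (g : metric_tree_aut R) (radius n)))[].
  by apply: nbhsx_ballx; apply: radius_gt0.
move=> h [Ah]; rewrite ballEmdist /= => gh; exists h => //.
exact: tree_dist_agree.
Qed.

Definition cylinder n g : set (metric_tree_aut R) := [set h | agree n g h].

Local Open Scope ereal_scope.

Lemma diam_cylinder n g : diam (cylinder n g) <= (radius n)%:E.
Proof.
apply: ge_ereal_sup => z [->|]; first by rewrite lee_fin ltW ?radius_gt0.
move=> [x gx [y gy <-]]; rewrite lee_fin; apply: tree_dist_le.
exact: agree_trans (agree_sym gx) gy.
Qed.

Lemma diam_ge0 (T : metricType R) (A : set T) : 0 <= diam A.
Proof. by apply: ereal_sup_ubound; left. Qed.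

Lemma diam0 (T : metricType R) : diam (set0 : set T) = 0.
Proof.
apply/eqP; rewrite eq_le diam_ge0 andbT.
by apply: ge_ereal_sup => z [->//|[x []]].
Qed.

Lemma hausdorff_premeasure_ge0 (T : metricType R) s delta (E : set T) :
  0 <= hausdorff_premeasure s delta E.
Proof.
apply: le_ereal_inf_tmp => _ [U _ <-]; apply: nneseries_ge0 => k _ _.
exact: poweR_ge0.
Qed.

(** Cylinders at level [n] have diameter at most [radius n], so covers at arbitrarily deep levels
    bound the premeasure for every [delta]. *)
Lemma hausdorff_measure_cover0 (s : R) (E : set (metric_tree_aut R)) :
  (0 < s)%R ->
  (forall n0 (e : R), (0 < e)%R -> exists n (L : seq tree_aut),
    [/\ (n0 <= n)%N, forall g, E g -> exists2 h, h \in L & agree n h g &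
     ((size L)%:R * radius n `^ s <= e)%R]) ->
  hausdorff_measure s E = 0.
Proof.
move=> s0 cover; apply/eqP; rewrite eq_le; apply/andP; split; last first.
  apply: le_ereal_sup_tmp; exists (hausdorff_premeasure s 1 E); last first.
    exact: hausdorff_premeasure_ge0.
  by exists 1%R => //=; apply: ltr01.
apply: ge_ereal_sup => _ [delta /= delta0 <-].
apply/lee_addgt0Pr => e e0; rewrite add0e.
have [n0 n0d] : exists n0, (radius n0 <= delta)%R.
  exists (Num.truncn delta^-1).+1; apply: le_trans (radius_ge _) _.
  by rewrite invf_ple ?posrE ?ltr0n// ltW// truncnS_gt.
have [n [L [n0n LP Le]]] := cover n0 e e0.
(* The finite cover is padded with empty sets, which contribute 0 because [s] is positive. *)
pose U j := if (j < size L)%N then cylinder n (nth 1%g L j) else set0.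
apply: le_trans (ereal_inf_lbound _) _.
  exists U => //; split.
    move=> g Eg; have [h hL hg] := LP g Eg.
    exists (index h L) => //; rewrite /U index_mem hL.
    by rewrite /cylinder /= nth_index.
  move=> j; rewrite /U; case: ifP => _; last by rewrite diam0 lee_fin ltW.
  apply: le_trans (diam_cylinder _ _) _; rewrite lee_fin.
  exact: le_trans (radius_le n0n) n0d.
have U0 j : 0 <= diam (U j) `^ s by apply: poweR_ge0.
rewrite (@nneseries_split _ _ 0%N (size L))// add0n eseries0 ?adde0; last first.
  by move=> j Lj _; rewrite /U ltnNge Lj diam0 poweR0r// gt_eqF.
apply: (@le_trans _ _ (\sum_(0 <= j < size L) (radius n `^ s)%:E)).
  apply: lee_sum => j _; rewrite /U; case: ifP => _; last first.
    by rewrite diam0 poweR0r ?gt_eqF// lee_fin powR_ge0.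
  rewrite -poweR_EFin; apply: (gt0_ler_poweR (ltW s0));
    rewrite ?in_itv/= ?leey ?andbT.
  - exact: diam_ge0.
  - by rewrite lee_fin ltW ?radius_gt0.
  - exact: diam_cylinder.
by rewrite sumEFin lee_fin sumr_const_nat subn0 -mulr_natl.
Qed.

End Metric.

(** * Lower bound for the dimension of the full group *)

Section LowerBound.
Variable R : realType.
Implicit Types x y : R.

(** For [x] in [0, 1[, the binary digit of weight [2 ^- j.+1]. *)
Definition digit x (j : nat) : bool := odd (Num.truncn (2 ^+ j.+1 * x)).

Lemma truncn_digit x j : 0 <= x ->
  Num.truncn (2 ^+ j.+1 * x) = ((Num.truncn (2 ^+ j * x)).*2 + digit x j)%N.
Proof.
move=> x0; rewrite /digit; set m := Num.truncn (2 ^+ j.+1 * x).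
have z0 i : 0 <= 2 ^+ i * x by rewrite mulr_ge0 ?exprn_ge0.
have := truncn_itv (z0 j.+1); rewrite -/m -[in X in X -> _](odd_double_half m).
move=> /andP[m1 m2].
rewrite [LHS](esym (odd_double_half m)) addnC; congr (_.*2 + _)%N.
apply/esym/truncn_def; move: m1 m2; rewrite -mul2n -!natr1 natrD natrM exprS -mulrA.
by case: (odd m) => /= m1 m2; apply/andP; split; lra.
Qed.

(* The distance of two such automorphisms bounds that of their parameters, so the
   preimages in [0, 1[ of the sets of a covering of G form a covering of [0, 1[
   by sets of no larger diameters. *)
Definition binary_aut x : tree_aut :=
  aut_of_label (fun w => digit x (heap_index w)).

(** Agreement on [n] levels means equality of the first [2 ^ n - 1] digits, so both parameters lie
    in one dyadic interval of length [radius R n]. *)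
Lemma binary_aut_close x y n : 0 <= x < 1 -> 0 <= y < 1 ->
  agree n (binary_aut x) (binary_aut y) -> `|x - y| <= radius R n.
Proof.
move=> /andP[x0 x1] /andP[y0 y1] xy.
have dig j : (j < 2 ^ n - 1)%N -> digit x j = digit y j.
  move=> jn; have [w wj] := heap_index_surj j.
  have := xy w; rewrite !label_aut_of_label wj; apply.
  by rewrite -heap_index_lt wj.
have tr N : (N <= 2 ^ n - 1)%N -> Num.truncn (2 ^+ N * x) = Num.truncn (2 ^+ N * y).
  elim: N => [_|N IH Nn]; last by rewrite !truncn_digit// dig// IH// ltnW.
  by rewrite expr0 !mul1r !(@truncn_def _ _ 0)// ?x0 ?y0.
have := tr _ (leqnn _); rewrite /radius natrX; set K := 2 ^+ (2 ^ n - 1) => xyK.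
have K0 : 0 < K :> R by rewrite exprn_gt0.
have [/andP[a1 a2] /andP[b1 b2]] :
    ((Num.truncn (K * x))%:R <= K * x < (Num.truncn (K * x)).+1%:R) /\
    ((Num.truncn (K * x))%:R <= K * y < (Num.truncn (K * x)).+1%:R).
  by split; [|rewrite xyK]; apply: truncn_itv; rewrite mulr_ge0// ltW.
rewrite -[K^-1]mul1r ler_pdivlMr// mulrC -[X in X * _]gtr0_norm// -normrM.
rewrite ler_norml; move: a1 a2 b1 b2; rewrite -natr1 => *.
by apply/andP; split; lra.
Qed.

Lemma binary_aut_lipschitz x y : 0 <= x < 1 -> 0 <= y < 1 ->
  `|x - y| <= tree_dist R (binary_aut x) (binary_aut y).
Proof.
move=> xI yI; have [bxy|bxy] := eqVneq (binary_aut x) (binary_aut y); last first.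
  by have [n [xyn ->]] := tree_distE R bxy; apply: binary_aut_close.
(* Equal images agree on all levels, so the parameters are closer than any positive [e]. *)
rewrite bxy /tree_dist eqxx; apply/ler_addgt0Pr => e e0; rewrite add0r.
have xyn : agree (Num.truncn e^-1).+1 (binary_aut x) (binary_aut y) by rewrite bxy.
apply: le_trans (binary_aut_close xI yI xyn) _.
apply: le_trans (radius_ge _ _) _.
by rewrite invf_ple ?posrE ?ltr0n// ltW// truncnS_gt.
Qed.

Local Open Scope ereal_scope.

(** Lebesgue measure is compared on [0, 1[. The factor 1/2 arises because each preimage is enclosed
    in an interval centred at one of its points, of length twice the diameter. *)
Lemma sum_diam_ge (U : nat -> set (metric_tree_aut R)) :
  (forall g, exists k, U k g) -> (forall k, diam (U k) <= 1) ->
  2^-1%:E <= \sum_(0 <= k <oo) diam (U k).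
Proof.
move=> Ucover U1.
have Ufin k : diam (U k) = (fine (diam (U k)))%:E.
  by rewrite fineK// ge0_fin_numE ?diam_ge0// (le_lt_trans (U1 k)) ?ltry.
pose dk k := fine (diam (U k)).
have dk0 k : (0 <= dk k)%R by rewrite -lee_fin -Ufin diam_ge0.
pose V k := [set x : R | (0 <= x < 1)%R /\ U k (binary_aut x)].
(* The default centre 0 occurs only for an empty preimage, which any interval contains. *)
pose xk k := xget 0%R (V k).
pose F k := `[(xk k - dk k)%R, (xk k + dk k)%R]%classic.
have FV k : V k `<=` F k.
  move=> y Vy; have [xI Ux] : V k (xk k) by apply: xgetPex; exists y.
  have [yI Uy] := Vy; rewrite /F /= in_itv /=.
  have : (`|xk k - y| <= dk k)%R.
    rewrite -lee_fin -Ufin; apply: le_trans; last first.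
      by apply: ereal_sup_ubound; right; exists (binary_aut (xk k)) => //;
        exists (binary_aut y).
    by rewrite lee_fin mdist_tree binary_aut_lipschitz.
  by rewrite ler_norml => /andP[? ?]; apply/andP; split; lra.
have muF k : lebesgue_measure (F k) = 2%:E * diam (U k).
  rewrite /F lebesgue_measure_itv /= lte_fin Ufin -EFinM -/(dk k).
  case: ltP => [_|d0]; first by rewrite -EFinB; congr _%:E; ring.
  congr _%:E; have := dk0 k; lra.
have : lebesgue_measure `[0%R, 1%R[%classic <=
    \sum_(0 <= k <oo) lebesgue_measure (F k).
  apply: (@measure_sigma_subadditive _ _ _ (@lebesgue_measure R)) => //.
    by move=> k; apply: measurable_itv.
  move=> x /=; rewrite in_itv /= => xI; have [k Uk] := Ucover (binary_aut x).
  by exists k => //; apply: FV.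
rewrite lebesgue_measure_itv /= lte_fin ltr01 sube0.
rewrite (eq_eseriesr (fun k _ => muF k)) nneseriesZl; last first.
  by move=> *; apply: diam_ge0.
by move=> le1; rewrite -(@lee_pmul2l _ 2%:E)// -EFinM divff.
Qed.

(** For [s < 1] and diameters at most 1, passing to the power [s] does not decrease them, so the
    measure is at least 1/2. *)
Lemma hausdorff_dim_full (E : set (metric_tree_aut R)) :
  (forall g, E g) -> 1 <= hausdorff_dim E.
Proof.
move=> ET; apply: le_ereal_inf_tmp => _ [s [s0 hs] <-]; rewrite lee_fin leNgt.
apply/negP => s1.
have : 2^-1%:E <= hausdorff_measure s E; last by rewrite hs lee_fin; lra.
apply: le_ereal_sup_tmp; exists (hausdorff_premeasure s 1 E).
  by exists 1%R => //=; apply: ltr01.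
apply: le_ereal_inf_tmp => _ [U [EU U1] <-].
have Ucover g : exists k, U k g by have [k _ ?] := EU _ (ET g); exists k.
apply: le_trans (sum_diam_ge Ucover U1) _.
apply: lee_nneseries => k; first by rewrite diam_ge0.
move=> _; have := U1 k; have := diam_ge0 (U k).
case: (diam (U k)) => [r| |]//; rewrite !lee_fin => r0 r1.
have [->|rn0] := eqVneq r 0%R.
  by rewrite powR_ge0.
by apply: ger1_powR => //; [rewrite lt_neqAle eq_sym rn0 r0|exact: ltW].
Qed.

End LowerBound.

(** * Upper bound for the dimension and conclusion *)

Section UpperBound.
Variable R : realType.

Lemma radius_powR n (s : R) :
  radius R n `^ s = 2 `^ (- (2 ^+ n - 1) * s).
Proof.
rewrite powRrM; congr (_ `^ s); rewrite /radius natrX.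
have -> : 2 ^+ n - 1 = (2 ^ n - 1)%N%:R :> R by rewrite natrB ?expn_gt0// natrX.
by rewrite powR_invn.
Qed.

(* The midpoint of 1 - 1 / 2^(d-1) and 1 - 2 / 2^(d-1), for d = k + 2. *)
Definition exponent k : R := 1 - 3 / (2 * 2 ^+ k.+1).

(** With [D], [M] and [t] as in the proof, [D * t = 3 / 2] makes the exponent of 2 equal to
    [3 - D - M - t], which is at most [1 - M]. *)
Lemma pattern_cover_sum k m :
  (2 ^ ((2 ^ k.+1 - 2) * (2 ^ m.+1 - 1)))%N%:R *
    radius R (k.+1 + m.+1) `^ exponent k <= 2 / 2 ^+ (2 ^ m) :> R.
Proof.
have D2 : 2 <= 2 ^+ k.+1 :> R.
  by rewrite -[leLHS]expr1 ler_weXn2l// ler1n.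
rewrite radius_powR natrX -powR_mulrn// -powRD; last by rewrite pnatr_eq0 implybT.
have -> : 2 / 2 ^+ (2 ^ m) = 2 `^ (1 - 2 ^+ m) :> R.
  rewrite powRB; last by rewrite pnatr_eq0 implybT.
  by rewrite powRr1// -[in LHS]powR_mulrn// natrX.
apply: ler_powR; first by rewrite ler1n.
rewrite natrM !natrB ?expn_gt0//; last first.
  by rewrite -{1}(expn1 2) leq_exp2l.
rewrite !natrX exprD exprS [2 ^+ m.+1]exprS -exprS /exponent.
set D := 2 ^+ k.+1 in D2 *; set M := 2 ^+ m.
have tD : D * (3 / (2 * D)) = 3 / 2 by field; rewrite gt_eqF//; lra.
have t0 : 0 <= 3 / (2 * D) by rewrite divr_ge0//; lra.
move: tD t0; set t := 3 / (2 * D) => tD t0.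
have -> : - (D * (2 * M) - 1) * (1 - t) =
    (1 - t) - D * (2 * M) + 2 * M * (D * t) by ring.
by rewrite tD; lra.
Qed.

Lemma cover_sum_small k (C n0 : nat) (e : R) : 0 < e -> exists m,
  (n0 <= k.+1 + m)%N /\
  (C * 2 ^ ((2 ^ k.+1 - 2) * (2 ^ m - 1)))%N%:R *
    radius R (k.+1 + m) `^ exponent k <= e.
Proof.
move=> e0; pose c := Num.truncn (C%:R * 2 / e).
(* The summand [n0] ensures the depth; [c] makes the doubly exponential decay beat the constant
   [C * 2 / e]. *)
exists (n0 + c).+1; split.
  by rewrite addnS -addSn (leq_trans (leq_addr c n0))// leq_addl.
rewrite natrM -mulrA.
apply: le_trans (ler_wpM2l _ (pattern_cover_sum k (n0 + c))) _.
  exact: ler0n.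
rewrite mulrA ler_pdivrMr ?exprn_gt0// [e * _]mulrC -ler_pdivrMr//.
apply: le_trans (ltW (truncnS_gt _)) _; rewrite -natrX ler_nat.
have [a b] : (c < 2 ^ (n0 + c))%N /\ (2 ^ (n0 + c) <= 2 ^ 2 ^ (n0 + c))%N.
  split.
    apply: leq_trans (ltn_expl c (ltnSn 1)) _.
    by rewrite leq_exp2l// leq_addl.
  by rewrite ltnW// ltn_expl.
exact: leq_trans a b.
Qed.

End UpperBound.

Theorem theorem2 (R : realType) (d : nat) (P : {group {perm d.-bseq bool}})
  (hd : (2 <= d)%N)
  (hP : (P \subset trunc_aut d)%g)
  (hess : essential P)
  (hdim : hausdorff_dim (fin_constrained P : set (metric_tree_aut R)) =
    (1 - 1 / 2 ^+ d.-1)%R%:E) :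
  ~ topologically_fg R (fin_constrained P).
Proof.
case: d P hd hP hess hdim => [|[|k]]// P _ hP hess hdim [S Sfin HS].
have QM := @root_patternM _ P; have QV := @root_patternV _ P.
have Qagree := @root_pattern_agree _ P.
have Q1 := root_pattern1 P.
have Qess := root_pattern_ess hP hess.
have GE := fin_constrainedE hP.
have Dgt0 : 0 < 2 ^+ k.+1 :> R by rewrite exprn_gt0.
(* Otherwise the covers bound the dimension by [exponent R k], which is smaller than the given
   value. *)
have Qindex a b : agree k.+1 1%g a -> agree k.+1 1%g b ->
    [\/ root_pattern P a, root_pattern P b | root_pattern P (a * b)%g].
  move=> sa sb; apply: contrapT => nab.
  have [C cover] := constrained_cover QM QV Qagree sa sb
    (fun Qa => nab (Or31 _ _ Qa)) (fun Qb => nab (Or32 _ _ Qb))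
    (fun Qab => nab (Or33 _ _ Qab)).
  have s0 : 0 < exponent R k.
    rewrite /exponent subr_gt0 ltr_pdivrMr ?mulr_gt0// mul1r.
    have : 2 <= 2 ^+ k.+1 :> R by rewrite -[leLHS]expr1 ler_weXn2l// ler1n.
    lra.
  suff : (hausdorff_dim (fin_constrained P : set (metric_tree_aut R)) <=
      (exponent R k)%:E)%E.
    rewrite hdim lee_fin /exponent lerD2l lerN2 /= ler_pdivrMr ?mulr_gt0//.
    by rewrite mulrCA mul1r mulVf ?gt_eqF//; lra.
  apply: ereal_inf_lbound; exists (exponent R k) => //; split=> //.
  apply: hausdorff_measure_cover0 => // n0 e e0.
  have [m [n0m me]] := cover_sum_small k C n0 e0.
  have [L sL LP] := cover m; exists (k.+1 + m)%N, L; split=> //.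
    by move=> g /GE; apply: LP.
  by apply: le_trans me; rewrite ler_wpM2r ?powR_ge0// ler_nat.
(* Otherwise [pattern_all] makes the constrained group the whole group, of dimension at least 1. *)
have [tau [stau nQtau]] : exists tau, agree k.+1 1%g tau /\ ~ root_pattern P tau.
  apply: contrapT => ntau.
  suff : (1 <= hausdorff_dim (fin_constrained P : set (metric_tree_aut R)))%E.
    rewrite hdim lee_fin lerBrDl gerDr /= leNgt divr_gt0//.
  apply: hausdorff_dim_full => g; apply/GE => w.
  apply: (pattern_all Q1 QM Qess Qindex) => a sa.
  by apply: contrapT => nQa; apply: ntau; exists a.
have SK g : S g -> constrained (root_pattern P) g.
  move=> Sg; apply/GE; rewrite HS; apply: subset_closure.
  by move=> A [_]; apply.
have [g [n [Kg ng]]] := not_dense_fg Q1 QM QV Qagree Qess Qindex stau nQtau Sfin SK.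
(* If [S] generated topologically, [g] would agree on [n] levels with an element of the generated
   subgroup. *)
have : fin_constrained P g by apply/GE.
rewrite HS => /(closure_agree n)[h Sh gh].
exact: ng Sh gh.
Qed.
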